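(* Let $S$ be a Hermitian positive definite $n\times n$ matrix and let $Q$ be a nonsingular $n\times n$ matrix. Then $$\mathrm{sign}\left(\begin{bmatrix}0 & Q^*S \\ Q & 0\end{bmatrix}\right) = \begin{bmatrix} 0 & Z^*S \\ Z & 0 \end{bmatrix},$$ where $Z = Q (Q^*S Q)^{-1/2}$, and $ZZ^* = S^{-1}$.
   Context: Matrices are complex and $^*$ denotes the conjugate transpose. For a square matrix $X$ with no eigenvalues on the imaginary axis, the matrix sign function is $\mathrm{sign}(X) = X(X^2)^{-1/2}$, where $(\cdot)^{1/2}$ denotes the principal square root and $(\cdot)^{-1/2}$ its inverse. Part of the assertion is that the sign function is defined for the $2n\times 2n$ matrix in question. *)

(* Defs.v *)
From mathcomp Require Import all_boot all_order all_algebra.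
From mathcomp Require Import boolp classical_sets reals.
From mathcomp Require Export complex.

Set Implicit Arguments.
Unset Strict Implicit.
Unset Printing Implicit Defensive.

Import Order.TTheory GRing.Theory Num.Theory.
Local Open Scope ring_scope.
Local Open Scope classical_set_scope.
Local Open Scope sesquilinear_scope.

Section MatrixFunctions.
Variable C : numClosedFieldType.

(* In C, [0 < z] means that z is real and positive. *)
Definition posdefmx n (S : 'M[C]_n) : Prop :=
  S \is hermsymmx /\
  forall x : 'cV[C]_n, x != 0 -> 0 < (x ^t* *m S *m x) 0 0.

Definition is_psqrtmx n (A X : 'M[C]_n) : Prop :=
  X *m X = A /\ forall l : C, eigenvalue X l -> 0 < 'Re l.

(* Principal square root; the value is 0 when none exists. It is unique when
   it exists, see [psqrtmx_eq] below. *)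
Definition psqrtmx n (A : 'M[C]_n) : 'M[C]_n :=
  xget 0 [set X | is_psqrtmx A X].

Definition signmx_defined n (X : 'M[C]_n) : Prop :=
  forall l : C, eigenvalue X l -> 'Re l != 0.

Definition signmx n (X : 'M[C]_n) : 'M[C]_n :=
  X *m invmx (psqrtmx (X *m X)).

Lemma is_psqrtmx_uniq n (A X Y : 'M[C]_n) :
  is_psqrtmx A X -> is_psqrtmx A Y -> X = Y.
Proof.
move=> [XX Xpos] [YY Ypos]; apply/eqP; rewrite -subr_eq0.
set D := X - Y; apply: contraT => D_neq0.
have XD : X *m D = - (D *m Y).
  by rewrite /D mulmxBr mulmxBl XX YY opprB.
clearbody D.
pose B := row_base D.
have B_free : row_free B by exact: row_base_free.
have rD_gt0 : (0 < \rank D)%N by rewrite lt0n mxrank_eq0.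
have Ystab : stablemx B Y.
  rewrite stablemx_row_base; apply/submxP; exists (- X).
  by rewrite mulNmx XD opprK.
have [a /eigenvalueP[v vY v_neq0]] := eigenvalue_closed (conjmx B Y) rD_gt0.
have : (v *m B <= D)%MS by rewrite mulmx_sub // eq_row_base.
set w := v *m B => wD.
have w_neq0 : w != 0 by rewrite mulmx_free_eq0.
have wY : w *m Y = a *: w.
  by apply/eigenspaceP; rewrite -sub_eigenspace_conjmx //; apply/eigenspaceP.
have a_pos : 0 < 'Re a by apply: Ypos; apply/eigenvalueP; exists w.
have [u wu] := submxP wD.
have Xa : X + a%:M \in unitmx.
  rewrite -row_free_unit -kermx_eq0 -[a]opprK raddfN -[_ == 0]negbK.
  apply/negP => /Xpos; rewrite raddfN oppr_gt0 => /(lt_trans a_pos).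
  by rewrite ltxx.
have uK : (u *m (X + a%:M) <= kermx D)%MS.
  apply/sub_kermxP; rewrite mulmxDr mulmxDl -(mulmxA u X) XD mulmxN mulmxA.
  by rewrite -wu wY mul_mx_scalar -scalemxAl -wu addNr.
have KX : (kermx D *m (X + a%:M) <= kermx D)%MS.
  apply/sub_kermxP; rewrite mulmxDr mulmxDl -(mulmxA _ X) XD mulmxN mulmxA.
  by rewrite mul_mx_scalar -scalemxAl mulmx_ker mul0mx oppr0 scaler0 addr0.
have : (kermx D <= kermx D *m (X + a%:M))%MS.
  by rewrite -(geq_leqif (mxrank_leqif_sup KX)) mxrankMfree // row_free_unit.
move=> /(submx_trans uK)/(submxMr (invmx (X + a%:M))).
rewrite !mulmxK // => /sub_kermxP uD0.
by rewrite wu uD0 eqxx in w_neq0.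
Qed.

Lemma psqrtmx_eq n (A X : 'M[C]_n) : is_psqrtmx A X -> psqrtmx A = X.
Proof. by move=> AX; apply: xget_unique => // Y /(is_psqrtmx_uniq AX). Qed.

End MatrixFunctions.

(* Main.v *)
(* Since X^2 = diag(M, Q M Q^-1) with M = Q^* S Q positive definite, if P is
   the principal square root of M, obtained from a unitary diagonalization,
   then T = diag(P, Q P Q^-1) is the one of X^2. Moreover
   Z^* S = P^-1 Q^* S = P^-1 M Q^-1 = P Q^-1, so sign(X) T = X can be
   checked blockwise for the claimed sign(X), and Z Z^* S = Z P Q^-1 = 1. *)
Require Import Defs.
From mathcomp Require Import all_boot all_order all_algebra.
From mathcomp Require Import reals.

Import Order.TTheory GRing.Theory Num.Theory.
Local Open Scope ring_scope.
Local Open Scope sesquilinear_scope.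

Section Eigenvalues.
Context {F : fieldType}.

Lemma eigenvalue_diag_mx {n} (d : 'rV[F]_n) (a : F) :
  eigenvalue (diag_mx d) a = [exists i, d 0 i == a].
Proof.
apply/eigenvalueP/existsP => [[v vd /rV0Pn[i vi0]]|[i /eqP <-]].
  exists i; move/rowP/(_ i): vd; rewrite mul_mx_diag !mxE mulrC.
  by move=> /(mulIf vi0) ->.
exists (delta_mx 0 i); last by apply/rV0Pn; exists i; rewrite !mxE !eqxx oner_eq0.
apply/rowP=> j; rewrite mul_mx_diag !mxE eqxx /=.
by case: eqP => [->|_]; rewrite ?mulr0 ?mul0r // mul1r mulr1.
Qed.

(** Eigenvectors are row vectors, so if [v] is one for the conjugate, then [v *m U] is one for
    [A]. *)
Lemma eigenvalue_similar {n} (U A : 'M[F]_n) (a : F) :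
  U \in unitmx -> eigenvalue (U *m A *m invmx U) a -> eigenvalue A a.
Proof.
move=> Uu /eigenvalueP[v vA v0]; apply/eigenvalueP; exists (v *m U).
  by rewrite -[v *m U *m A](mulmxKV Uu) -!(mulmxA v) mulmxA vA scalemxAl.
by apply: contraNneq v0 => vU0; rewrite -[v](mulmxK Uu) vU0 mul0mx.
Qed.

(** Cut an eigenvector into two halves: each nonzero half is an eigenvector of its block. *)
Lemma eigenvalue_block_diag {m n} (A : 'M[F]_m) (B : 'M[F]_n) (a : F) :
  eigenvalue (block_mx A 0 0 B) a -> eigenvalue A a \/ eigenvalue B a.
Proof.
move=> /eigenvalueP[v]; rewrite -[v]hsubmxK.
move: (lsubmx v) (rsubmx v) => u w.
rewrite mul_row_block !mulmx0 addr0 add0r scale_row_mx => /eq_row_mx[uA wB].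
have [-> | u0 _] := eqVneq u 0; last by left; apply/eigenvalueP; exists u.
have [-> | w0 _] := eqVneq w 0; first by rewrite row_mx0 eqxx.
by right; apply/eigenvalueP; exists w.
Qed.

End Eigenvalues.

Section PositiveDefinite.
Context {C : numClosedFieldType}.

Lemma trmxC_mul {m n p} (A : 'M[C]_(m, n)) (B : 'M[C]_(n, p)) :
  (A *m B) ^t* = B ^t* *m A ^t*.
Proof. by rewrite trmx_mul map_mxM. Qed.

Lemma trmxC_inv {n} (A : 'M[C]_n) : (invmx A) ^t* = invmx (A ^t*).
Proof. by rewrite trmx_inv map_invmx. Qed.

Lemma hermsymmxP {n} (A : 'M[C]_n) : reflect (A ^t* = A) (A \is hermsymmx).
Proof.
by apply: (iffP (is_hermitianmxP _ _ _)); rewrite expr0 scale1r => /esym.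
Qed.

(** Testing the form on the column [v ^t*] of a row eigenvector [v] gives [a] times the squared norm
    of [v]. *)
Lemma posdefmx_eigenvalue {n} {A : 'M[C]_n} {a : C} :
  posdefmx A -> eigenvalue A a -> 0 < a.
Proof.
move=> [_ Apos] /eigenvalueP[v vA v0].
have := Apos (v ^t*); rewrite trmxCK vA -scalemxAl mxE => av.
have vv : 0 < (v *m v ^t*) 0 0 by rewrite -dotmxE dnorm_gt0.
rewrite -(pmulr_lgt0 _ vv) av //.
by apply: contraNneq v0 => v0; rewrite -[v]trmxCK v0 trmx0 map_mx0.
Qed.

Lemma posdefmx_unit {n} {A : 'M[C]_n} : posdefmx A -> A \in unitmx.
Proof.
move=> Apos; rewrite -row_free_unit -kermx_eq0; apply/negPn/negP => A0.
have := @posdefmx_eigenvalue _ A 0 Apos.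
by rewrite ltxx /eigenvalue /eigenspace raddf0 subr0 => /(_ A0).
Qed.

(** The form at [x] is the form of [S] at [Q *m x], which is nonzero with [x]. *)
Lemma posdefmx_congr {n} {S Q : 'M[C]_n} :
  posdefmx S -> Q \in unitmx -> posdefmx (Q ^t* *m S *m Q).
Proof.
move=> [/hermsymmxP Sh Spos] Qu; split.
  by apply/hermsymmxP; rewrite !trmxC_mul trmxCK Sh mulmxA.
move=> x x0; rewrite !mulmxA -trmxC_mul -mulmxA; apply: Spos.
by apply: contraNneq x0 => Qx0; rewrite -[x](mulKmx Qu) Qx0 mulmx0.
Qed.

(** Take square roots of the eigenvalues in a unitary diagonalization. That the root is Hermitian is
    needed later to compute [Z ^t*]. *)
Lemma posdefmx_psqrt {n} {A : 'M[C]_n} : posdefmx A ->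
  exists2 P, is_psqrtmx A P & P \is hermsymmx.
Proof.
move=> Apos; have [Ah _] := Apos.
have := orthomx_spectralP (hermitian_normalmx Ah).
have := spectral_unit A; have := spectral_unitarymx A.
move: (spectralmx A) (spectral_diag A) => U d Uun Uu AE.
(* Conjugating [A] by [U] gives [diag_mx d], so each [d 0 i] is an eigenvalue of [A]. *)
have d_gt0 i : 0 < d 0 i.
  apply: (posdefmx_eigenvalue Apos); apply: (eigenvalue_similar _ _ _ Uu).
  rewrite AE !mulmxA mulmxV // mul1mx mulmxK // eigenvalue_diag_mx.
  by apply/existsP; exists i.
pose s := map_mx sqrtC d.
have s_gt0 i : 0 < s 0 i by rewrite mxE sqrtC_gt0.
exists (invmx U *m diag_mx s *m U); first split.
- rewrite AE !mulmxA mulmxK // -(mulmxA _ (diag_mx s) (diag_mx s)) mulmx_diag.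
  by congr (_ *m diag_mx _ *m _); apply/rowP => i; rewrite !mxE -expr2 sqrtCK.
(* Writing the last [U] as the inverse of [invmx U] shows a conjugate of [diag_mx s]. *)
- move=> a; rewrite -{2}[U]invmxK => /eigenvalue_similar.
  rewrite unitmx_inv eigenvalue_diag_mx => /(_ Uu)/existsP[i /eqP <-].
  by rewrite (Creal_ReP _ _) ?gtr0_real.
apply/hermsymmxP; rewrite !trmxC_mul invmx_unitary // trmxCK mulmxA.
rewrite tr_diag_mx map_diag_mx; congr (_ *m diag_mx _ *m _).
by apply/rowP => i; rewrite [LHS]mxE; apply/conj_Creal/gtr0_real.
Qed.

Lemma is_psqrtmx_similar {n} (U A P : 'M[C]_n) : U \in unitmx ->
  is_psqrtmx A P -> is_psqrtmx (U *m A *m invmx U) (U *m P *m invmx U).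
Proof.
move=> Uu [<- Ppos]; split; last by move=> a /(eigenvalue_similar _ _ _ Uu)/Ppos.
by rewrite !mulmxA mulmxKV.
Qed.

Lemma is_psqrtmx_block_diag {m n} (A P : 'M[C]_m) (B T : 'M[C]_n) :
  is_psqrtmx A P -> is_psqrtmx B T ->
  is_psqrtmx (block_mx A 0 0 B) (block_mx P 0 0 T).
Proof.
move=> [<- Ppos] [<- Tpos]; split; last first.
  by move=> a /eigenvalue_block_diag[/Ppos | /Tpos].
by rewrite mulmx_block !mulmx0 !mul0mx !addr0 !add0r.
Qed.

(** The square of an eigenvalue of [X] is an eigenvalue of [X *m X], but the square of a purely
    imaginary number is never positive. *)
Lemma signmx_defined_of_sqr {n} (X : 'M[C]_n) :
  (forall a, eigenvalue (X *m X) a -> 0 < a) -> signmx_defined X.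
Proof.
move=> Xpos a /eigenvalueP[v vX v0]; apply/eqP => Rea0.
have : 0 < a ^+ 2.
  apply: Xpos; apply/eigenvalueP; exists v => //.
  by rewrite mulmxA vX -scalemxAl vX scalerA.
rewrite [a]Crect Rea0 add0r exprMn sqrCi mulN1r oppr_gt0 => /lt_geF.
by rewrite real_exprn_even_ge0 ?Creal_Im.
Qed.

(** By uniqueness of the principal root, a sign is certified by one product, without computing the
    inverse of [T]. *)
Lemma signmx_eq {n} (X Y T : 'M[C]_n) :
  is_psqrtmx (X *m X) T -> T \in unitmx -> Y *m T = X -> signmx X = Y.
Proof.
by move=> XXT Tu YT; rewrite /signmx (psqrtmx_eq XXT) -{1}YT mulmxK.
Qed.

End PositiveDefinite.

Theorem theorem2p1 (R : realType) (n : nat) (S Q : 'M[R[i]]_n)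
    (hS : posdefmx S) (hQ : Q \in unitmx) :
  let X : 'M[R[i]]_(n + n) := block_mx 0 (Q ^t* *m S) Q 0 in
  let Z : 'M[R[i]]_n := Q *m invmx (psqrtmx (Q ^t* *m S *m Q)) in
  [/\ signmx_defined X,
      signmx X = block_mx 0 (Z ^t* *m S) Z 0
    & Z *m Z ^t* = invmx S].
Proof.
move=> X Z; pose M := Q ^t* *m S *m Q.
have Mpos : posdefmx M := posdefmx_congr hS hQ.
have [P MP /hermsymmxP Ph] := posdefmx_psqrt Mpos.
have PP : P *m P = M by case: MP.
have Pu : P \in unitmx.
  by have := posdefmx_unit Mpos; rewrite -PP unitmx_mul andbb.
have ZE : Z = Q *m invmx P by rewrite /Z (psqrtmx_eq MP).
have XX : X *m X = block_mx M 0 0 (Q *m M *m invmx Q).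
  rewrite mulmx_block !mulmx0 !mul0mx !addr0 !add0r.
  by rewrite /M !mulmxA mulmxK.
have XXsqrt : is_psqrtmx (X *m X) (block_mx P 0 0 (Q *m P *m invmx Q)).
  by rewrite XX; apply/is_psqrtmx_block_diag/is_psqrtmx_similar.
have ZS : Z ^t* *m S = P *m invmx Q.
  rewrite ZE trmxC_mul trmxC_inv Ph -mulmxA -(mulmxK hQ (Q ^t* *m S)).
  by rewrite -/M -PP !mulmxA mulVmx // mul1mx.
split.
(* The block [Q *m M *m invmx Q] need not be Hermitian; its spectrum is positive by similarity to
   [M]. *)
- apply: signmx_defined_of_sqr => a; rewrite XX.
  move=> /eigenvalue_block_diag[|/(eigenvalue_similar _ _ _ hQ)];
    exact: posdefmx_eigenvalue.
- apply: signmx_eq XXsqrt _ _.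
    by rewrite unitmxE det_ublock unitrM -!unitmxE !unitmx_mul unitmx_inv hQ Pu.
  (* Lower left: [Z *m P = Q]. Upper right: [P *m P *m invmx Q = M *m invmx Q], which is
     [Q ^t* *m S]. *)
  rewrite mulmx_block !mulmx0 !mul0mx !addr0 !add0r ZS ZE mulmxKV //.
  by rewrite !mulmxA mulmxKV // PP mulmxK.
- have ZZS : Z *m Z ^t* *m S = 1%:M.
    by rewrite -mulmxA ZS ZE mulmxA mulmxKV // mulmxV.
  by rewrite -[LHS](mulmxK (posdefmx_unit hS)) ZZS mul1mx.
Qed.
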